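(* Let $(\mathscr{K},\otimes,\mathbf{1},\alpha,\lambda,\rho)$ be an $\mathbf{Ab}$-enriched monoidal category, let $(M,\mu,\eta)$ be a monoid object in $\mathscr{K}$ and let $(X,\nu,\omega)$ be an $M$-bimodule object. Let $A$ be the Hochschild cosimplicial object, with objects $A^k$ ($k\ge 0$) and coface operations $\delta^i:A^k\to A^{k+1}$. The following procedure turns the cosimplicial object $A$ into a cochain complex: for $k<0$ set $A^k=0$, and define the differential $d^k:A^k\to A^{k+1}$ by $$d^k=\begin{cases}0&\text{if } k<0,\\ \delta^0-\delta^1&\text{if } k=0,\\ \sum_{i=0}^{k+1}(-1)^i\delta^i&\text{if } k>0.\end{cases}$$ Moreover, this cochain complex equals the Hochschild cochain complex $(C^\bullet(M;X),d^\bullet)$.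
   Context: Monoidal categories are not assumed strict: $\alpha_{X,Y,Z}:(X\otimes Y)\otimes Z\to X\otimes(Y\otimes Z)$ is the associator, $\lambda_X:\mathbf{1}\otimes X\to X$ and $\rho_X:X\otimes\mathbf{1}\to X$ are the left and right unitors, satisfying the pentagon and triangle axioms. A category is $\mathbf{Ab}$-enriched if its hom-sets are abelian groups and composition is bilinear over $\mathbb{Z}$; an $\mathbf{Ab}$-enriched monoidal category is a monoidal category which is $\mathbf{Ab}$-enriched in this sense (no biproducts are assumed). A cochain complex is a sequence of objects and arrows $d^k:C^k\to C^{k+1}$, $k\in\mathbb{Z}$, with $d^k\circ d^{k-1}=0$ for all $k$. A monoid object $(M,\mu,\eta)$ is an object $M$ with $\mu:M\otimes M\to M$ and $\eta:\mathbf{1}\to M$ such that $\mu\circ(\mu\otimes 1_M)=\mu\circ(1_M\otimes\mu)\circ\alpha_{M,M,M}$, $\mu\circ(\eta\otimes 1_M)\circ\lambda_M^{-1}=1_M$ and $\mu\circ(1_M\otimes\eta)\circ\rho_M^{-1}=1_M$. An $M$-bimodule object $(X,\nu,\omega)$ is an object $X$ with a left action $\nu:M\otimes X\to X$ and a right action $\omega:X\otimes M\to X$ such that $\nu\circ(\mu\otimes 1_X)=\nu\circ(1_M\otimes\nu)\circ\alpha_{M,M,X}$, $\nu\circ(\eta\otimes 1_X)=\lambda_X$, $\omega\circ(\omega\otimes 1_M)=\omega\circ(1_X\otimes\mu)\circ\alpha_{X,M,M}$, $\omega\circ(1_X\otimes\eta)=\rho_X$, and $\omega\circ(\nu\otimes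 1_M)=\nu\circ(1_M\otimes\omega)\circ\alpha_{M,X,M}$. Tensor powers are bracketed to the left: $M^{\otimes 1}=M$ and $M^{\otimes k}=M^{\otimes(k-1)}\otimes M$. For a morphism $g$ write $g\otimes 1_M^{r}$ for $(\cdots((g\otimes 1_M)\otimes 1_M)\cdots)\otimes 1_M$ ($r$ factors $1_M$). For $k\ge 2$, $\alpha^1_{M^{\otimes k}}:M^{\otimes k}\to M\otimes M^{\otimes(k-1)}$ is the composite $$\alpha^1_{M^{\otimes k}}=\alpha_{M,M^{\otimes(k-2)},M}\circ\cdots\circ(\alpha_{M,M^{\otimes 2},M}\otimes 1_M^{k-4})\circ(\alpha_{M,M,M}\otimes 1_M^{k-3}),$$ which is the (empty composite) identity for $k=2$. The Hochschild cosimplicial object: $A^0=\mathrm{Hom}_{\mathscr{K}}(\mathbf{1},X)$ and $A^k=\mathrm{Hom}_{\mathscr{K}}(M^{\otimes k},X)$ for $k>0$, with coface operations $\delta^i:A^k\to A^{k+1}$, $0\le i\le k+1$: - for $k=0$, $f\in A^0$: $\delta^0(f)=\omega\circ(f\otimes 1_M)\circ\lambda_M^{-1}$ and $\delta^1(f)=\nu\circ(1_M\otimes f)\circ\rho_M^{-1}$; - for $k>0$, $f\in A^k$: $\delta^0(f)=\nu\circ(1_M\otimes f)\circ\alpha^1_{M^{\otimes(k+1)}}$; $\delta^1(f)=f\circ(\mu\otimes 1_M^{k-1})$; $\delta^i(f)=f\circ\big((1_{M^{\otimes(i-1)}}\otimes\mu)\otimes 1_M^{k-i}\big)\circ\big(\alpha_{M^{\otimes(i-1)},M,M}\otimes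 1_M^{k-i}\big)$ for $2\le i\le k$; $\delta^{k+1}(f)=\omega\circ(f\otimes 1_M)$ (using $M^{\otimes(k+1)}=M^{\otimes k}\otimes M$). (It also carries codegeneracy operations $A^{k+1}\to A^k$, given by inserting $\eta$, which are not used in this statement.) The Hochschild cochain complex $(C^\bullet(M;X),d^\bullet)$: $C^k(M;X)=0$ for $k<0$, $C^0(M;X)=\mathrm{Hom}_{\mathscr{K}}(\mathbf{1},X)$, $C^k(M;X)=\mathrm{Hom}_{\mathscr{K}}(M^{\otimes k},X)$ for $k>0$. Its differentials $d^k:C^k(M;X)\to C^{k+1}(M;X)$ are: $d^k=0$ for $k<0$; for $k=0$, $d^0(f)=\omega\circ(f\otimes 1_M)\circ\lambda_M^{-1}-\nu\circ(1_M\otimes f)\circ\rho_M^{-1}$; for $k>0$, $d^k(f)=\sum_{i=0}^{k+1}(-1)^i\chi_i$, where the outer summands are $\chi_0=\nu\circ(1_M\otimes f)\circ\alpha^1_{M^{\otimes(k+1)}}$ and $\chi_{k+1}=\omega\circ(f\otimes 1_M)$, and the inner summands, obtained by applying $\mu$ to the $i$-th adjacent pair of factors of $M^{\otimes(k+1)}$ and then $f$, are $\chi_1=f\circ(\mu\otimes 1_M^{k-1})$ and $\chi_i=f\circ\big((1_{M^{\otimes(i-1)}}\otimes\mu)\otimes 1_M^{k-i}\big)\circ\big(\alpha_{M^{\otimes(i-1)},M,M}\otimes 1_M^{k-i}\big)$ for $2\le i\le k$.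
   Formalization: The tensor product is additionally assumed biadditive on morphisms; with only bilinear composition the claim fails, e.g. in (Ab, ⊕, 0) with M = X nonzero, μ addition, ν(m,x) = x, ω(x,m) = x + m, where d^1(d^0(0)) ≠ 0. *)

(* Defs.v *)
From mathcomp Require Import all_boot all_order all_algebra.

Set Implicit Arguments.
Unset Strict Implicit.
Unset Printing Implicit Defensive.

Import GRing.Theory.
Local Open Scope ring_scope.

Reserved Notation "g ∘ f" (at level 40, left associativity).
Reserved Notation "a ⊗ b" (at level 38, left associativity).
Reserved Notation "f ⊠ g" (at level 38, left associativity).

Record abCategory : Type := AbCategory {
  ob :> Type;
  mor : ob -> ob -> zmodType;
  idm : forall a, mor a a;
  mcomp : forall a b c, mor b c -> mor a b -> mor a c;
  mcompA : forall a b c d (h : mor c d) (g : mor b c) (f : mor a b),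
    mcomp h (mcomp g f) = mcomp (mcomp h g) f;
  mcomp1m : forall a b (f : mor a b), mcomp (idm b) f = f;
  mcompm1 : forall a b (f : mor a b), mcomp f (idm a) = f;
  mcompDl : forall a b c (g g' : mor b c) (f : mor a b),
    mcomp (g + g') f = mcomp g f + mcomp g' f;
  mcompDr : forall a b c (g : mor b c) (f f' : mor a b),
    mcomp g (f + f') = mcomp g f + mcomp g f'
}.

Arguments mor {C} _ _ : rename.
Arguments idm {C} _ : rename.
Arguments mcomp {C a b c} _ _ : rename.

Notation "g ∘ f" := (mcomp g f).

(** Enrichment is understood in the usual sense for monoidal categories: the
    tensor product is biadditive on morphisms ([tensmDl], [tensmDr]).  Bilinear
    composition alone is not enough to obtain a complex.  In (Ab, ⊕, 0) every
    abelian group M is a monoid under addition, and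
    [ν (m, x) = x], [ω (x, m) = x + m] make M a bimodule over itself; then d^0
    sends 0 to the identity of M and d^1 (d^0 0) is the second projection. *)
Record abMonoidalCategory : Type := AbMonoidalCategory {
  mcat :> abCategory;
  tens : mcat -> mcat -> mcat;
  tensm : forall a b c d : mcat,
    mor a b -> mor c d -> mor (tens a c) (tens b d);
  tunit : mcat;
  tensm1 : forall a b : mcat, tensm (idm a) (idm b) = idm (tens a b);
  tensmM : forall (a b c a' b' c' : mcat) (g : mor b c) (f : mor a b)
      (g' : mor b' c') (f' : mor a' b'),
    tensm (g ∘ f) (g' ∘ f') = tensm g g' ∘ tensm f f';
  tensmDl : forall (a b c d : mcat) (f f' : mor a b) (g : mor c d),
    tensm (f + f') g = tensm f g + tensm f' g;
  tensmDr : forall (a b c d : mcat) (f : mor a b) (g g' : mor c d),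
    tensm f (g + g') = tensm f g + tensm f g';
  assoc : forall a b c : mcat, mor (tens (tens a b) c) (tens a (tens b c));
  assocV : forall a b c : mcat, mor (tens a (tens b c)) (tens (tens a b) c);
  assocK : forall a b c : mcat, assocV a b c ∘ assoc a b c = idm _;
  assocVK : forall a b c : mcat, assoc a b c ∘ assocV a b c = idm _;
  assoc_nat : forall (a b c a' b' c' : mcat)
      (f : mor a a') (g : mor b b') (h : mor c c'),
    assoc a' b' c' ∘ tensm (tensm f g) h
    = tensm f (tensm g h) ∘ assoc a b c;
  lunit : forall a : mcat, mor (tens tunit a) a;
  lunitV : forall a : mcat, mor a (tens tunit a);
  lunitK : forall a : mcat, lunitV a ∘ lunit a = idm _;
  lunitVK : forall a : mcat, lunit a ∘ lunitV a = idm _;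
  lunit_nat : forall (a b : mcat) (f : mor a b),
    lunit b ∘ tensm (idm tunit) f = f ∘ lunit a;
  runit : forall a : mcat, mor (tens a tunit) a;
  runitV : forall a : mcat, mor a (tens a tunit);
  runitK : forall a : mcat, runitV a ∘ runit a = idm _;
  runitVK : forall a : mcat, runit a ∘ runitV a = idm _;
  runit_nat : forall (a b : mcat) (f : mor a b),
    runit b ∘ tensm f (idm tunit) = f ∘ runit a;
  pentagon : forall a b c d : mcat,
    assoc a b (tens c d) ∘ assoc (tens a b) c d
    = tensm (idm a) (assoc b c d) ∘ assoc a (tens b c) d
      ∘ tensm (assoc a b c) (idm d);
  triangle : forall a b : mcat,
    tensm (idm a) (lunit b) ∘ assoc a tunit b = tensm (runit a) (idm b)
}.

Arguments tens {K} _ _ : rename.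
Arguments tensm {K a b c d} _ _ : rename.
Arguments tunit {K} : rename.
Arguments assoc {K} _ _ _ : rename.
Arguments assocV {K} _ _ _ : rename.
Arguments lunit {K} _ : rename.
Arguments lunitV {K} _ : rename.
Arguments runit {K} _ : rename.
Arguments runitV {K} _ : rename.

Notation "a ⊗ b" := (tens a b).
Notation "f ⊠ g" := (tensm f g).

Record monoidObject (K : abMonoidalCategory) : Type := MonoidObject {
  mob :> K;
  mmul : mor (mob ⊗ mob) mob;
  munit : mor tunit mob;
  mmulA : mmul ∘ (mmul ⊠ idm mob)
          = mmul ∘ (idm mob ⊠ mmul) ∘ assoc mob mob mob;
  mmul1l : mmul ∘ (munit ⊠ idm mob) ∘ lunitV mob = idm mob;
  mmul1r : mmul ∘ (idm mob ⊠ munit) ∘ runitV mob = idm mob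
}.

Record bimoduleObject (K : abMonoidalCategory) (M : monoidObject K) : Type :=
  BimoduleObject {
  bob :> K;
  lact : mor (M ⊗ bob) bob;
  ract : mor (bob ⊗ M) bob;
  lactA : lact ∘ (mmul M ⊠ idm bob) = lact ∘ (idm M ⊠ lact) ∘ assoc _ _ _;
  lact1 : lact ∘ (munit M ⊠ idm bob) = lunit bob;
  ractA : ract ∘ (ract ⊠ idm M) = ract ∘ (idm bob ⊠ mmul M) ∘ assoc _ _ _;
  ract1 : ract ∘ (idm bob ⊠ munit M) = runit bob;
  lract : ract ∘ (lact ⊠ idm M) = lact ∘ (idm M ⊠ ract) ∘ assoc _ _ _
}.

(* [k + 1], in a form that computes on the constructors of [int] *)
Definition zsucc (k : int) : int :=
  match k with
  | Posz n => Posz n.+1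
  | Negz 0 => Posz 0
  | Negz n.+1 => Negz n
  end.

Lemma zsuccE k : zsucc k = k + 1.
Proof.
case: k => [n|[|n]] //; first by rewrite /= intS addrC.
by rewrite /= !NegzE -[n.+2]addn1 PoszD opprD addrNK.
Qed.

Record cochain_seq : Type := CochainSeq {
  cobj : int -> zmodType;
  cdiff : forall k : int, cobj k -> cobj (zsucc k)
}.

Definition is_cochain_complex (C : cochain_seq) : Prop :=
  (forall k : int, zmod_morphism (@cdiff C k)) /\
  (forall (k : int) (x : cobj C k), cdiff (cdiff x) = 0).

(** The objects and cofaces of a cosimplicial abelian group; codegeneracies
    play no role in the associated complex. *)
Record cofaces : Type := Cofaces {
  cosobj : nat -> zmodType;
  coface : forall k : nat, 'I_k.+2 -> cosobj k -> cosobj k.+1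
}.

Definition extend0 (A : nat -> zmodType) (k : int) : zmodType :=
  match k with
  | Posz n => A n
  | Negz _ => 'I_1
  end.

Definition alternating_diff (A : cofaces) (k : int) :
    extend0 (cosobj A) k -> extend0 (cosobj A) (zsucc k) :=
  match k with
  | Posz 0 => fun f => coface (ord0 : 'I_2) f - coface (ord_max : 'I_2) f
  | Posz n.+1 => fun f =>
      \sum_(i < n.+3) coface i f *~ (-1) ^+ i
  | Negz 0 => fun=> 0
  | Negz n.+1 => fun=> 0
  end.

Definition alternating_complex (A : cofaces) : cochain_seq :=
  CochainSeq (@alternating_diff A).

Section TensorPowers.
Variables (K : abMonoidalCategory) (M : monoidObject K).

(* [tpow 0] is the unit object, while [tpow 1 = M]: no factor [tunit] occurs in
   positive powers. *)
Fixpoint tpow (n : nat) : K :=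
  match n with
  | 0 => tunit
  | n'.+1 => if n' is _.+1 then tpow n' ⊗ M else M
  end.

(* (...((a ⊗ M) ⊗ M)...) ⊗ M, with r factors M *)
Fixpoint tensr (a : K) (r : nat) : K :=
  if r is r'.+1 then tensr (a ⊗ M) r' else a.

(* (...((g ⊗ 1_M) ⊗ 1_M)...) ⊗ 1_M, with r factors 1_M *)
Fixpoint whisk (a b : K) (r : nat) (g : mor a b) :
    mor (tensr a r) (tensr b r) :=
  match r with
  | 0 => g
  | r'.+1 => whisk r' (g ⊠ idm M)
  end.

Lemma tensr_tpow (m r n : nat) :
  (m.+1 + r)%N = n -> tensr (tpow m.+1) r = tpow n.
Proof.
elim: r m => [|r IHr] m mrn; first by rewrite -mrn addn0.
by apply: (IHr m.+1); rewrite -mrn addnS.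
Qed.

(* the morphism [g] viewed between equal objects *)
Definition castm (a a' b b' : K) (ea : a = a') (eb : b = b') (g : mor a b) :
    mor a' b' :=
  match ea in _ = x, eb in _ = y return mor x y with
  | erefl, erefl => g
  end.

(* [assoc1_whisk n r] is the composite
     (α_{M,M^n,M} ⊗ 1^r) ∘ (α_{M,M^(n-1),M} ⊗ 1^(r+1)) ∘ ...
       ∘ (α_{M,M,M} ⊗ 1^(r+n-1)),
   which is the identity for n = 0. *)
Fixpoint assoc1_whisk (n r : nat) :
    mor (tensr (tpow n.+2) r) (tensr (M ⊗ tpow n.+1) r) :=
  match n with
  | 0 => idm _
  | n'.+1 => whisk r (assoc M (tpow n'.+1) M) ∘ assoc1_whisk n' r.+1
  end.

(* α^1 on M^{⊗(n+2)} *)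
Definition assoc1 (n : nat) : mor (tpow n.+2) (M ⊗ tpow n.+1) :=
  assoc1_whisk n 0.

(* μ ⊗ 1^(k-1) for k = n+1 *)
Definition mul_first (n : nat) : mor (tpow n.+2) (tpow n.+1) :=
  castm (@tensr_tpow 1 n n.+2 erefl) (@tensr_tpow 0 n n.+1 erefl)
    (whisk n (mmul M)).

(* ((1_{M^(i-1)} ⊗ μ) ⊗ 1^(k-i)) ∘ (α_{M^(i-1),M,M} ⊗ 1^(k-i)) for i = j+2 *)
Definition mul_at (k j : nat) (h : (j.+2 <= k)%N) :
    mor (tpow k.+1) (tpow k) :=
  castm (@tensr_tpow j.+2 (k - j.+2) k.+1 (congr1 S (subnKC h)))
        (@tensr_tpow j.+1 (k - j.+2) k (subnKC h))
    (whisk (k - j.+2) (idm (tpow j.+1) ⊠ mmul M)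
     ∘ whisk (k - j.+2) (assoc (tpow j.+1) M M)).

End TensorPowers.

Section Hochschild.
Variables (K : abMonoidalCategory) (M : monoidObject K).
Variable X : bimoduleObject M.

Definition hoch_obj (k : nat) : zmodType := mor (tpow M k) X.

Definition hoch_coface (k : nat) : 'I_k.+2 -> hoch_obj k -> hoch_obj k.+1 :=
  match k with
  | 0 => fun i f =>
      if val i is 0 then ract X ∘ (f ⊠ idm M) ∘ lunitV M
      else lact X ∘ (idm M ⊠ f) ∘ runitV M
  | n.+1 => fun i f =>
      match val i with
      | 0 => lact X ∘ (idm M ⊠ f) ∘ assoc1 M n
      | 1 => f ∘ mul_first M n
      | j.+2 =>
          if @idP (j.+2 <= n.+1)%N is ReflectT h then f ∘ mul_at M h
          else ract X ∘ (f ⊠ idm M)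
      end
  end.

Definition hoch_cosimplicial : cofaces := Cofaces hoch_coface.

Definition hoch_chi_first (n : nat) (f : hoch_obj n.+1) : hoch_obj n.+2 :=
  lact X ∘ (idm M ⊠ f) ∘ assoc1 M n.

Definition hoch_chi_last (n : nat) (f : hoch_obj n.+1) : hoch_obj n.+2 :=
  ract X ∘ (f ⊠ idm M).

(* inner summands: [hoch_chi_inner f i] is χ_{i+1}, for 1 <= i+1 <= k *)
Definition hoch_chi_inner (n : nat) (f : hoch_obj n.+1) (i : 'I_n.+1) :
    hoch_obj n.+2 :=
  match i with
  | Ordinal 0 _ => f ∘ mul_first M n
  | Ordinal j.+1 h => f ∘ mul_at M h
  end.

Definition hoch_diff (k : int) :
    extend0 hoch_obj k -> extend0 hoch_obj (zsucc k) :=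
  match k with
  | Posz 0 => fun f : hoch_obj 0 =>
      ract X ∘ (f ⊠ idm M) ∘ lunitV M - lact X ∘ (idm M ⊠ f) ∘ runitV M
  | Posz n.+1 => fun f : hoch_obj n.+1 =>
      hoch_chi_first f
      + \sum_(i < n.+1) hoch_chi_inner f i *~ (-1) ^+ i.+1
      + hoch_chi_last f *~ (-1) ^+ n.+2
  | Negz 0 => fun=> 0
  | Negz n.+1 => fun=> 0
  end.

Definition hoch_complex : cochain_seq := CochainSeq hoch_diff.

End Hochschild.

(* Main.v *)
Require Import Defs.
From mathcomp Require Import all_boot all_order all_algebra.
From mathcomp Require Import boolp.

(** Bracketing to the left makes the alternating sum D_n of the inner faces of
    M^(n+2) recursive: D_(n+1) = D_n ⊗ 1 + (-1)^(n+1) P, where P multiplies the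
    last two factors.  Naturality of P and associativity of μ then give
    D_n D_(n+1) = 0 by induction.  Writing d f = L f - f D_n + (-1)^n R f, with L
    and R the outer faces, d (d f) = 0 follows from L R = R L, R (R f) = (R f) P,
    L (L f) = (L f) F and L (f D_n) = (L f) (F - D_(n+1)), with F the first inner
    face; the last two are inductions on the pentagon.  The case d^1 d^0 = 0 uses
    the coherence of the unitors with α instead. *)

Set Implicit Arguments.
Unset Strict Implicit.
Unset Printing Implicit Defensive.

Import GRing.Theory.
Local Open Scope ring_scope.

(** * Biadditivity of composition and of the tensor product *)

Section Additivity.
Variable K : abMonoidalCategory.
Implicit Types a b c d : K.

Lemma mcompBl a b c (g g' : mor b c) (f : mor a b) :
  (g - g') ∘ f = g ∘ f - g' ∘ f.
Proof. by apply/eqP; rewrite eq_sym subr_eq -mcompDl subrK. Qed.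

Lemma mcompBr a b c (g : mor b c) (f f' : mor a b) :
  g ∘ (f - f') = g ∘ f - g ∘ f'.
Proof. by apply/eqP; rewrite eq_sym subr_eq -mcompDr subrK. Qed.

Lemma tensmBl a b c d (f f' : mor a b) (g : mor c d) :
  (f - f') ⊠ g = f ⊠ g - f' ⊠ g.
Proof. by apply/eqP; rewrite eq_sym subr_eq -tensmDl subrK. Qed.

Lemma tensmBr a b c d (f : mor a b) (g g' : mor c d) :
  f ⊠ (g - g') = f ⊠ g - f ⊠ g'.
Proof. by apply/eqP; rewrite eq_sym subr_eq -tensmDr subrK. Qed.

Lemma mcomp0m a b c (f : mor a b) : (0 : mor b c) ∘ f = 0.
Proof. by rewrite -(subrr 0) mcompBl subrr. Qed.

Lemma mcompm0 a b c (g : mor b c) : g ∘ (0 : mor a b) = 0.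
Proof. by rewrite -(subrr 0) mcompBr subrr. Qed.

Lemma tens0m a b c d (g : mor c d) : (0 : mor a b) ⊠ g = 0.
Proof. by rewrite -(subrr 0) tensmBl subrr. Qed.

Lemma tensm0 a b c d (f : mor a b) : f ⊠ (0 : mor c d) = 0.
Proof. by rewrite -(subrr 0) tensmBr subrr. Qed.

Lemma mcompNl a b c (g : mor b c) (f : mor a b) : (- g) ∘ f = - (g ∘ f).
Proof. by rewrite -sub0r mcompBl mcomp0m sub0r. Qed.

Lemma mcompNr a b c (g : mor b c) (f : mor a b) : g ∘ (- f) = - (g ∘ f).
Proof. by rewrite -sub0r mcompBr mcompm0 sub0r. Qed.

Lemma tensmNl a b c d (f : mor a b) (g : mor c d) : (- f) ⊠ g = - (f ⊠ g).
Proof. by rewrite -sub0r tensmBl tens0m sub0r. Qed.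

Lemma tensmNr a b c d (f : mor a b) (g : mor c d) : f ⊠ (- g) = - (f ⊠ g).
Proof. by rewrite -sub0r tensmBr tensm0 sub0r. Qed.

Lemma mcomp_sumr a b c (g : mor b c) (I : finType) (F : I -> mor a b) :
  g ∘ (\sum_i F i) = \sum_i g ∘ F i.
Proof.
by apply: (big_morph (mcomp g)); [exact: mcompDr|exact: mcompm0].
Qed.

Lemma tensm_suml a b c d (g : mor c d) (I : finType) (F : I -> mor a b) :
  (\sum_i F i) ⊠ g = \sum_i F i ⊠ g.
Proof.
by apply: (big_morph (fun f => f ⊠ g)) => [f f'|]; rewrite ?tensmDl ?tens0m.
Qed.

Lemma mulrz_signS (V : zmodType) (x : V) n :
  x *~ (-1) ^+ n.+1 = - (x *~ (-1) ^+ n).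
Proof. by rewrite exprS mulN1r mulrNz. Qed.

Lemma mcomp_signl a b c (g : mor b c) (f : mor a b) n :
  (g *~ (-1) ^+ n) ∘ f = (g ∘ f) *~ (-1) ^+ n.
Proof. by elim: n => // n IHn; rewrite !mulrz_signS mcompNl IHn. Qed.

Lemma mcomp_signr a b c (g : mor b c) (f : mor a b) n :
  g ∘ (f *~ (-1) ^+ n) = (g ∘ f) *~ (-1) ^+ n.
Proof. by elim: n => // n IHn; rewrite !mulrz_signS mcompNr IHn. Qed.

Lemma tensm_signl a b c d (f : mor a b) (g : mor c d) n :
  (f *~ (-1) ^+ n) ⊠ g = (f ⊠ g) *~ (-1) ^+ n.
Proof. by elim: n => // n IHn; rewrite !mulrz_signS tensmNl IHn. Qed.

Lemma tensm_signr a b c d (f : mor a b) (g : mor c d) n :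
  f ⊠ (g *~ (-1) ^+ n) = (f ⊠ g) *~ (-1) ^+ n.
Proof. by elim: n => // n IHn; rewrite !mulrz_signS tensmNr IHn. Qed.

Lemma tensm_idl_comp a b c d (g : mor c d) (f : mor b c) :
  idm a ⊠ (g ∘ f) = (idm a ⊠ g) ∘ (idm a ⊠ f).
Proof. by rewrite -tensmM mcomp1m. Qed.

Lemma tensm_idr_comp a b c d (g : mor c d) (f : mor b c) :
  (g ∘ f) ⊠ idm a = (g ⊠ idm a) ∘ (f ⊠ idm a).
Proof. by rewrite -tensmM mcomp1m. Qed.

Lemma tensm_interchange a b c d (f : mor a b) (g : mor c d) :
  (f ⊠ idm d) ∘ (idm a ⊠ g) = (idm b ⊠ g) ∘ (f ⊠ idm c).
Proof. by rewrite -!tensmM !mcomp1m !mcompm1. Qed.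

Lemma mcomp_rcancel a b c (e : mor a b) (e' : mor b a) (g g' : mor b c) :
  e ∘ e' = idm b -> g ∘ e = g' ∘ e -> g = g'.
Proof.
by move=> ee' eg; rewrite -(mcompm1 g) -ee' mcompA eg -mcompA ee' mcompm1.
Qed.

Lemma mcomp_lcancel a b c (e : mor b c) (e' : mor c b) (f f' : mor a b) :
  e' ∘ e = idm b -> e ∘ f = e ∘ f' -> f = f'.
Proof.
by move=> ee' ef; rewrite -(mcomp1m f) -ee' -mcompA ef mcompA ee' mcomp1m.
Qed.

End Additivity.

(** * Compatibility of the unitors with the associator *)

Section UnitCoherence.
Variable K : abMonoidalCategory.
Implicit Types a b : K.

Lemma pentagonE (a b c d : K) :
  (idm a ⊠ assoc b c d) ∘ (assoc a (b ⊗ c) d ∘ (assoc a b c ⊠ idm d))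
  = assoc a b (c ⊗ d) ∘ assoc (a ⊗ b) c d.
Proof. by rewrite mcompA pentagon. Qed.

Lemma tensm_unitl_inj a b (f g : mor a b) :
  idm tunit ⊠ f = idm tunit ⊠ g -> f = g.
Proof.
move=> fg; apply: (mcomp_rcancel (lunitVK a)).
by rewrite -!lunit_nat fg.
Qed.

Lemma tensm_unitr_inj a b (f g : mor a b) :
  f ⊠ idm tunit = g ⊠ idm tunit -> f = g.
Proof.
move=> fg; apply: (mcomp_rcancel (runitVK a)).
by rewrite -!runit_nat fg.
Qed.

(* Kelly: both sides agree after tensoring with the unit and precomposing with
   the isomorphism [assoc tunit (tunit ⊗ a) b ∘ (assoc tunit tunit a ⊠ 1)]. *)
Lemma lunit_tens a b :
  lunit (a ⊗ b) ∘ assoc tunit a b = lunit a ⊠ idm b.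
Proof.
apply: tensm_unitl_inj.
apply: (mcomp_rcancel (assocVK tunit (tunit ⊗ a) b)).
have ee : (assoc (tunit : K) tunit a ⊠ idm b) ∘ (assocV tunit tunit a ⊠ idm b)
    = idm _ by rewrite -tensm_idr_comp assocVK tensm1.
apply: (mcomp_rcancel ee).
rewrite -assoc_nat -!mcompA -tensm_idr_comp triangle tensm_idl_comp.
rewrite [RHS]assoc_nat tensm1 -triangle -!mcompA; congr (_ ∘ _).
by rewrite pentagon !mcompA.
Qed.

(** Mirror image of the argument for [lunit_tens]: the sides agree after tensoring with the unit on
    the right and postcomposing with [assoc a b tunit], by the pentagon and two triangles. *)
Lemma runit_tens a b :
  (idm a ⊠ runit b) ∘ assoc a b tunit = runit (a ⊗ b).
Proof.
apply: tensm_unitr_inj.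
apply: (mcomp_lcancel (assocK a b tunit)).
rewrite tensm_idr_comp mcompA assoc_nat -triangle tensm_idl_comp.
by rewrite -!mcompA pentagonE mcompA -assoc_nat tensm1 -mcompA triangle.
Qed.

End UnitCoherence.

(** * The product P of the last two factors *)

Section RightMultiplication.
Variables (K : abMonoidalCategory) (M : monoidObject K).
Implicit Types a b : K.

Definition mul_last a : mor (a ⊗ M ⊗ M) (a ⊗ M) :=
  (idm a ⊠ mmul M) ∘ assoc a M M.

Lemma mul_last_nat a b (g : mor a b) :
  mul_last b ∘ (g ⊠ idm M ⊠ idm M) = (g ⊠ idm M) ∘ mul_last a.
Proof.
by rewrite /mul_last -mcompA assoc_nat tensm1 !mcompA tensm_interchange.
Qed.

(** The pentagon followed by naturality of α; it lets P pass through the associators that make up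
    α^1. *)
Lemma mul_last_assoc a b :
  (idm a ⊠ mul_last b) ∘ assoc a (b ⊗ M) M ∘ (assoc a b M ⊠ idm M)
  = assoc a b M ∘ mul_last (a ⊗ b).
Proof.
rewrite /mul_last tensm_idl_comp -!mcompA pentagonE.
by rewrite !mcompA -assoc_nat tensm1.
Qed.

Lemma mul_lastA a :
  mul_last a ∘ (mul_last a ⊠ idm M) = mul_last a ∘ mul_last (a ⊗ M).
Proof.
have -> : mul_last a ∘ mul_last (a ⊗ M)
    = (idm a ⊠ mmul M) ∘ (assoc a M M ∘ mul_last (a ⊗ M)) by rewrite mcompA.
rewrite -mul_last_assoc.
rewrite [in LHS]/mul_last tensm_idr_comp -!mcompA.
rewrite [assoc a M M ∘ _]mcompA assoc_nat !mcompA -!tensm_idl_comp.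
by rewrite mmulA /mul_last mcompA.
Qed.

End RightMultiplication.

(** * The alternating sum of inner faces and its passage through α^1 *)

Section BarDifferential.
Variables (K : abMonoidalCategory) (M : monoidObject K).

Local Notation "M ^⊗ n" := (tpow M n) (at level 30, format "M ^⊗ n").

(** The face F, whiskered from the outside. It occurs in both [face_left_left] and
    [face_left_bar_diff] and cancels between them. *)
Fixpoint bar_first n : mor (M^⊗n.+2) (M^⊗n.+1) :=
  if n is n'.+1 then bar_first n' ⊠ idm M else mmul M.

Fixpoint bar_diff n : mor (M^⊗n.+2) (M^⊗n.+1) :=
  if n is n'.+1
  then bar_diff n' ⊠ idm M + mul_last M (M^⊗n'.+1) *~ (-1) ^+ n'.+1
  else mmul M.

Lemma bar_diffS n :
  bar_diff n.+1
  = bar_diff n ⊠ idm M + mul_last M (M^⊗n.+1) *~ (-1) ^+ n.+1.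
Proof. by []. Qed.

Lemma bar_diffK n : bar_diff n ∘ bar_diff n.+1 = 0.
Proof.
elim: n => [|n IHn].
  by rewrite /= expr1 mulrN1z mcompBr mmulA -mcompA subrr.
rewrite (bar_diffS n.+1) mulrz_signS mcompBr mcomp_signr.
(* Naturality moves P past the summand D_n ⊗ 1, associativity of μ past the summand P. *)
have -> : bar_diff n.+1 ∘ mul_last M (M^⊗n.+2)
    = (mul_last M (M^⊗n.+1) ∘ (bar_diff n.+1 ⊠ idm M)).
  rewrite bar_diffS tensmDl tensm_signl mcompDr mcompDl mcomp_signr mcomp_signl.
  by rewrite mul_last_nat mul_lastA.
(* Only the left factor is expanded: its part D_n ⊗ 1 dies by induction, its part P cancels the term
   just computed. *)
rewrite {1}bar_diffS mcompDl -tensm_idr_comp IHn tens0m add0r.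
by rewrite mcomp_signl subrr.
Qed.

Lemma whisk_id (a : K) r : whisk M r (idm a) = idm (tensr M a r).
Proof. by elim: r a => [|r IHr] a //=; rewrite tensm1 IHr. Qed.

Lemma whisk_comp (a b c : K) r (g : mor b c) (f : mor a b) :
  whisk M r (g ∘ f) = whisk M r g ∘ whisk M r f.
Proof.
by elim: r a b c g f => [|r IHr] a b c g f //=; rewrite tensm_idr_comp IHr.
Qed.

(** Trades the accumulator [r] for an outer whiskering; this yields the recursion [assoc1S] that
    drives the inductions below. *)
Lemma assoc1_whiskE n r : assoc1_whisk M n r = whisk M r (assoc1 M n).
Proof.
elim: n r => [|n IHn] r; first by rewrite whisk_id.
by rewrite /assoc1 /= !IHn whisk_comp.
Qed.

Lemma assoc1S n :
  assoc1 M n.+1 = assoc M (M^⊗n.+1) M ∘ (assoc1 M n ⊠ idm M).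
Proof. by rewrite /assoc1 /= assoc1_whiskE. Qed.

(** Through α^1, the i-th inner face on the last factors becomes the (i+1)-st on all of them: the
    first face is missing and every sign flips. *)
Lemma bar_diff_assoc1 n :
  (idm M ⊠ bar_diff n) ∘ assoc1 M n.+1
  = assoc1 M n ∘ (bar_first n.+1 - bar_diff n.+1).
Proof.
elim: n => [|n IHn].
  rewrite assoc1S /= tensm1 mcompm1 mcomp1m expr1 mulrN1z.
  by rewrite opprD opprK addNKr.
rewrite bar_diffS tensmDr mcompDl.
have -> : (idm M ⊠ (bar_diff n ⊠ idm M)) ∘ assoc1 M n.+2
    = assoc1 M n.+1 ∘ ((bar_first n.+1 - bar_diff n.+1) ⊠ idm M).
  rewrite assoc1S mcompA -assoc_nat -mcompA -tensm_idr_comp IHn.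
  by rewrite tensm_idr_comp mcompA -assoc1S.
have mul_assoc1 : (idm M ⊠ mul_last M (M^⊗n.+1)) ∘ assoc1 M n.+2
    = assoc1 M n.+1 ∘ mul_last M (M^⊗n.+2).
  rewrite assoc1S [in LHS]assoc1S tensm_idr_comp ![in LHS]mcompA mul_last_assoc.
  by rewrite -mcompA mul_last_nat [in LHS]mcompA -assoc1S.
have -> : bar_first n.+2 - bar_diff n.+2
    = (bar_first n.+1 - bar_diff n.+1) ⊠ idm M
      + mul_last M (M^⊗n.+2) *~ (-1) ^+ n.+1.
  by rewrite (bar_diffS n.+1) mulrz_signS tensmBl [in LHS]opprD opprK addrA.
by rewrite [in RHS]mcompDr tensm_signr mcomp_signl mul_assoc1 mcomp_signr.
Qed.

(** Splitting off two factors M, regrouping them and multiplying amounts to the first inner face;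
    this is what two left actions in a row require. *)
Lemma bar_first_assoc1 n :
  (mmul M ⊠ idm (M^⊗n.+1)) ∘ assocV M M (M^⊗n.+1)
    ∘ (idm M ⊠ assoc1 M n) ∘ assoc1 M n.+1
  = assoc1 M n ∘ bar_first n.+1.
Proof.
elim: n => [|n IHn].
  rewrite assoc1S /= tensm1 tensm1 !mcompm1 mcomp1m.
  by rewrite -mcompA assocK mcompm1.
(* The pentagon solved for the inverse associator. *)
have aVV : assocV M M (M^⊗n.+1 ⊗ M) ∘ (idm M ⊠ assoc M (M^⊗n.+1) M)
      ∘ assoc M (M ⊗ M^⊗n.+1) M
    = assoc (M ⊗ M) (M^⊗n.+1) M ∘ (assocV M M (M^⊗n.+1) ⊠ idm M).
  have ee : (assoc M M (M^⊗n.+1) ⊠ idm M)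
      ∘ (assocV M M (M^⊗n.+1) ⊠ idm M) = idm _.
    by rewrite -tensm_idr_comp assocVK tensm1.
  apply: (mcomp_rcancel ee).
  rewrite -!mcompA pentagonE -tensm_idr_comp assocK tensm1 mcompm1.
  by rewrite mcompA assocK mcomp1m.
have -> : assoc1 M n.+1 ∘ bar_first n.+2
    = assoc M (M^⊗n.+1) M ∘ ((assoc1 M n ∘ bar_first n.+1) ⊠ idm M).
  by rewrite tensm_idr_comp mcompA -assoc1S.
rewrite -IHn.
rewrite (assoc1S n.+1) [in LHS](assoc1S n) tensm_idl_comp.
rewrite -!mcompA [(idm M ⊠ (_ ⊠ _)) ∘ _]mcompA -assoc_nat.
have mulV : (mmul M ⊠ idm (M^⊗n.+2)) ∘ assoc (M ⊗ M) (M^⊗n.+1) M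
    = assoc M (M^⊗n.+1) M ∘ (mmul M ⊠ idm (M^⊗n.+1) ⊠ idm M).
  by rewrite assoc_nat tensm1.
rewrite -!mcompA [_ ∘ (assoc M (M ⊗ M^⊗n.+1) M ∘ _)]mcompA.
rewrite [assocV M M _ ∘ _]mcompA [assocV M M _ ∘ (_ ∘ _)]mcompA aVV.
rewrite -mcompA [(mmul M ⊠ _) ∘ (assoc _ _ _ ∘ _)]mcompA mulV -assoc1S.
by rewrite -mcompA -!tensm_idr_comp.
Qed.

End BarDifferential.

(** * Identification of the recursive sum with the transported inner faces *)

Section Faces.
Variables (K : abMonoidalCategory) (M : monoidObject K).

Local Notation "M ^⊗ n" := (tpow M n) (at level 30, format "M ^⊗ n").

(** Objects form an arbitrary type, so their equality proofs are identified by
    [Prop_irrelevance]. *)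
Lemma castm_id (a b : K) (ea : a = a) (eb : b = b) (g : mor a b) :
  castm ea eb g = g.
Proof. by rewrite (Prop_irrelevance ea erefl) (Prop_irrelevance eb erefl). Qed.

(** [whisk] adds factors from the inside, [bar_diff] from the outside; the endpoint proofs are
    arbitrary so that the induction can shift [a] to [a ⊗ M]. *)
Lemma castm_whiskS (a b a' b' : K) r (g : mor a b)
    (ea : tensr M a r = a') (eb : tensr M b r = b')
    (eaM : tensr M a r.+1 = a' ⊗ M) (ebM : tensr M b r.+1 = b' ⊗ M) :
  castm eaM ebM (whisk M r.+1 g) = castm ea eb (whisk M r g) ⊠ idm M.
Proof.
elim: r a b g ea eb eaM ebM => [|r IHr] a b g ea eb eaM ebM.
  by case: _ / ea eaM => eaM; case: _ / eb ebM => ebM; rewrite !castm_id.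
exact: (IHr _ _ (g ⊠ idm M) ea eb).
Qed.

Lemma mul_first0 : mul_first M 0 = mmul M.
Proof. exact: castm_id. Qed.

Lemma mul_firstS n : mul_first M n.+1 = mul_first M n ⊠ idm M.
Proof. exact: castm_whiskS. Qed.

(** Replaces the subtraction, which does not compute, by a variable [r], and frees the transport
    proofs. *)
Lemma mul_atE k j r (h : (j.+2 <= k)%N) (er : r = (k - j.+2)%N)
    (ea : tensr M (M^⊗j.+3) r = M^⊗k.+1) (eb : tensr M (M^⊗j.+2) r = M^⊗k) :
  mul_at M h = castm ea eb (whisk M r (mul_last M (M^⊗j.+1))).
Proof.
subst r; rewrite /mul_at -whisk_comp.
by congr (castm _ _ _); apply: Prop_irrelevance.
Qed.

Lemma mul_at_last n (h : (n.+2 <= n.+2)%N) :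
  mul_at M h = mul_last M (M^⊗n.+1).
Proof.
by rewrite (mul_atE h (esym (subnn _)) erefl erefl).
Qed.

Lemma mul_atS n j (h : (j.+2 <= n.+1)%N) (h' : (j.+2 <= n.+2)%N) :
  mul_at M h' = mul_at M h ⊠ idm M.
Proof.
have er : (n.+1 - j.+2).+1 = (n.+2 - j.+2)%N by rewrite (subSn h).
have ea : tensr M (M^⊗j.+3) (n.+1 - j.+2) = M^⊗n.+2.
  by apply: tensr_tpow; rewrite addSn subnKC.
have eb : tensr M (M^⊗j.+2) (n.+1 - j.+2) = M^⊗n.+1.
  by apply: tensr_tpow; rewrite subnKC.
have eaM : tensr M (M^⊗j.+3) (n.+1 - j.+2).+1 = M^⊗n.+3.
  by apply: tensr_tpow; rewrite er addSn subnKC.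
have ebM : tensr M (M^⊗j.+2) (n.+1 - j.+2).+1 = M^⊗n.+2.
  by apply: tensr_tpow; rewrite er subnKC.
by rewrite (mul_atE h' er eaM ebM) (castm_whiskS _ ea eb) -(mul_atE h erefl).
Qed.

Definition inner_face n (i : 'I_n.+1) : mor (M^⊗n.+2) (M^⊗n.+1) :=
  match i with
  | Ordinal 0 _ => mul_first M n
  | Ordinal j.+1 h => mul_at M h
  end.

Lemma bar_diffE n : bar_diff M n = \sum_(i < n.+1) inner_face i *~ (-1) ^+ i.
Proof.
elim: n => [|n IHn].
  by rewrite big_ord_recl big_ord0 addr0 expr0 mulr1z [inner_face _]mul_first0.
rewrite big_ord_recr bar_diffS IHn tensm_suml; congr (_ + _ *~ _).
  apply: eq_bigr => i _; rewrite tensm_signl; congr (_ *~ _).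
  by case: i => [[|j] h]; rewrite /= ?mul_firstS ?mul_atS.
by rewrite /= mul_at_last.
Qed.

End Faces.

(** * The outer faces and the vanishing of d d in nonnegative degrees *)

Section HochschildDifferential.
Variables (K : abMonoidalCategory) (M : monoidObject K).
Variable X : bimoduleObject M.

Local Notation "M ^⊗ n" := (tpow M n) (at level 30, format "M ^⊗ n").
Local Notation face_left := (@hoch_chi_first K M X _).
Local Notation face_right := (@hoch_chi_last K M X _).

Lemma hoch_diffE n (f : hoch_obj X n.+1) :
  hoch_diff (k := Posz n.+1) f
  = face_left f - f ∘ bar_diff M n + face_right f *~ (-1) ^+ n.
Proof.
rewrite /= !mulrz_signS opprK; congr (_ + _ + _).
rewrite bar_diffE mcomp_sumr -sumrN; apply: eq_bigr => i _.
by rewrite mulrz_signS mcomp_signr; case: i => [[|j] h].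
Qed.

(** Associativity of the left action, solved for the inverse associator to match
    [bar_first_assoc1]. *)
Lemma lact_lact (a : K) (f : mor a X) :
  lact X ∘ (idm M ⊠ lact X) ∘ (idm M ⊠ (idm M ⊠ f))
  = lact X ∘ (idm M ⊠ f) ∘ ((mmul M ⊠ idm a) ∘ assocV M M a).
Proof.
apply: (mcomp_rcancel (assocVK M M a)).
rewrite -[LHS]mcompA -assoc_nat mcompA -lactA tensm1 -!mcompA assocK mcompm1.
by rewrite tensm_interchange.
Qed.

Lemma face_left_left n (f : hoch_obj X n.+1) :
  face_left (face_left f) = face_left f ∘ bar_first M n.+1.
Proof.
rewrite /hoch_chi_first !tensm_idl_comp -[RHS]mcompA -bar_first_assoc1.
by rewrite !mcompA lact_lact !mcompA.
Qed.

Lemma face_left_bar_diff n (f : hoch_obj X n.+1) :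
  face_left (f ∘ bar_diff M n)
  = face_left f ∘ bar_first M n.+1 - face_left f ∘ bar_diff M n.+1.
Proof.
rewrite /hoch_chi_first tensm_idl_comp -!mcompA bar_diff_assoc1.
by rewrite -!mcompBr.
Qed.

Lemma face_left_right n (f : hoch_obj X n.+1) :
  face_left (face_right f) = face_right (face_left f).
Proof.
rewrite /hoch_chi_first /hoch_chi_last assoc1S tensm_idl_comp !tensm_idr_comp.
by rewrite !mcompA lract -!mcompA; congr (_ ∘ (_ ∘ _)); rewrite !mcompA assoc_nat.
Qed.

Lemma face_right_right n (f : hoch_obj X n.+1) :
  face_right (face_right f) = face_right f ∘ mul_last M (M^⊗n.+1).
Proof.
rewrite /hoch_chi_last tensm_idr_comp mcompA ractA -[in RHS]mcompA.
by rewrite -mul_last_nat -!mcompA.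
Qed.

Lemma face_right_bar_diff n (f : hoch_obj X n.+1) :
  face_right f ∘ bar_diff M n.+1
  = face_right (f ∘ bar_diff M n)
    - face_right (face_right f) *~ (-1) ^+ n.
Proof.
rewrite bar_diffS mulrz_signS mcompBr mcomp_signr face_right_right.
by rewrite /hoch_chi_last tensm_idr_comp !mcompA.
Qed.

Lemma hoch_diffB_pos n (f g : hoch_obj X n.+1) :
  hoch_diff (k := Posz n.+1) (f - g)
  = hoch_diff (k := Posz n.+1) f - hoch_diff (k := Posz n.+1) g.
Proof.
rewrite !hoch_diffE /hoch_chi_first /hoch_chi_last.
rewrite tensmBr tensmBl !mcompBr !mcompBl mulrzBl.
rewrite [in RHS]opprD [RHS]addrACA; congr (_ + _).
by rewrite !opprB addrACA [RHS]addrACA; congr (_ + _); rewrite addrC.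
Qed.

Lemma hoch_diffK_pos n (f : hoch_obj X n.+1) :
  hoch_diff (k := Posz n.+2) (hoch_diff (k := Posz n.+1) f) = 0.
Proof.
rewrite [LHS]hoch_diffE mulrz_signS hoch_diffE.
have leftE (x y z : hoch_obj X n.+2) :
    face_left (x - y + z *~ (-1) ^+ n)
    = face_left x - face_left y + face_left z *~ (-1) ^+ n.
  rewrite /hoch_chi_first tensmDr tensmBr tensm_signr.
  by rewrite mcompDr mcompBr mcomp_signr mcompDl mcompBl mcomp_signl.
have rightE (x y z : hoch_obj X n.+2) :
    face_right (x - y + z *~ (-1) ^+ n)
    = face_right x - face_right y + face_right z *~ (-1) ^+ n.
  rewrite /hoch_chi_last tensmDl tensmBl tensm_signl.
  by rewrite mcompDr mcompBr mcomp_signr.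
rewrite leftE rightE mcompDl mcompBl mcomp_signl -[f ∘ _ ∘ _]mcompA.
rewrite bar_diffK mcompm0 subr0 face_left_left face_left_bar_diff subKr.
rewrite face_left_right face_right_bar_diff.
(* Here q = (L f) D_(n+1), u = R (f D_n), v = R (L f), w = (-1)^n R (R f) and s = (-1)^n; [subKr]
   has already removed F. *)
have cancel (V : zmodType) (q u v w : V) (s : int) :
    q + v *~ s - (q + (u - w) *~ s) - (v - u + w) *~ s = 0.
  rewrite opprD addrACA subrr add0r -!mulrzBl opprB addrA addrAC.
  by rewrite subrr mul0rz.
exact: cancel.
Qed.

Lemma hoch_diffK0 (f : hoch_obj X 0) :
  hoch_diff (k := Posz 1) (hoch_diff (k := Posz 0) f) = 0.
Proof.
rewrite hoch_diffE /= expr0 mulr1z /hoch_chi_first /hoch_chi_last /= mcompm1.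
set r := ract X ∘ _ ∘ _; set l := lact X ∘ _ ∘ _.
(* Three identities pair off the six terms of d^1 (r - l): R r = r μ, L l = l μ and L r = R l. *)
have rightr : ract X ∘ (r ⊠ idm M) = r ∘ mmul M.
  rewrite /r !tensm_idr_comp !mcompA ractA -!mcompA; congr (_ ∘ _).
  have lV : assoc tunit M M ∘ (lunitV M ⊠ idm M) = lunitV (M ⊗ M).
    apply: (mcomp_lcancel (lunitK (M ⊗ M))).
    by rewrite lunitVK mcompA lunit_tens -tensm_idr_comp lunitVK tensm1.
  have lVmul : lunitV M ∘ mmul M = (idm tunit ⊠ mmul M) ∘ lunitV (M ⊗ M).
    apply: (mcomp_lcancel (lunitK M)).
    by rewrite !mcompA lunitVK lunit_nat mcomp1m -mcompA lunitVK mcompm1.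
  rewrite lVmul -lV [assoc _ _ _ ∘ (_ ∘ _)]mcompA assoc_nat tensm1 !mcompA.
  by rewrite tensm_interchange.
have leftl : lact X ∘ (idm M ⊠ l) = l ∘ mmul M.
  have rV : assocV M M tunit ∘ (idm M ⊠ runitV M) = runitV (M ⊗ M).
    apply: (mcomp_lcancel (runitK (M ⊗ M))).
    rewrite runitVK -runit_tens -!mcompA [assoc _ _ _ ∘ _]mcompA assocVK mcomp1m.
    by rewrite -tensm_idl_comp runitVK tensm1.
  have rVmul : runitV M ∘ mmul M = (mmul M ⊠ idm tunit) ∘ runitV (M ⊗ M).
    apply: (mcomp_lcancel (runitK M)).
    by rewrite !mcompA runitVK runit_nat mcomp1m -mcompA runitVK mcompm1.
  by rewrite /l !tensm_idl_comp !mcompA lact_lact -!mcompA rVmul rV.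
have leftr : lact X ∘ (idm M ⊠ r) = ract X ∘ (l ⊠ idm M).
  rewrite /r /l !tensm_idl_comp !tensm_idr_comp !mcompA lract -!mcompA.
  congr (_ ∘ (_ ∘ _)); rewrite [RHS]mcompA assoc_nat -mcompA; congr (_ ∘ _).
  (* What remains is the triangle axiom with both unitors inverted, checked after precomposing with
     ρ ⊗ 1. *)
  have ee : (runit M ⊠ idm M) ∘ (runitV M ⊠ idm M) = idm _.
    by rewrite -tensm_idr_comp runitVK tensm1.
  have ee' : (runitV M ⊠ idm M) ∘ (runit M ⊠ idm M) = idm _.
    by rewrite -tensm_idr_comp runitK tensm1.
  apply: (mcomp_rcancel ee); rewrite -mcompA ee' mcompm1 -triangle mcompA.
  by rewrite -tensm_idl_comp lunitK tensm1 mcomp1m.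
rewrite tensmBr tensmBl !mcompBr mcompBl rightr leftl leftr.
have cancel (V : zmodType) (t a b : V) : t - b - (a - b) + (a - t) = 0.
  by rewrite opprB !addrA !subrK subrr.
exact: cancel.
Qed.

Lemma hoch_diffB0 (f g : hoch_obj X 0) :
  hoch_diff (k := Posz 0) (f - g)
  = hoch_diff (k := Posz 0) f - hoch_diff (k := Posz 0) g.
Proof.
rewrite /= tensmBr tensmBl !mcompBr !mcompBl.
by rewrite !opprB addrACA [RHS]addrACA; congr (_ + _); rewrite addrC.
Qed.

End HochschildDifferential.

(** * All degrees together, and the comparison of the two complexes *)

Lemma hoch_complexP (K : abMonoidalCategory) (M : monoidObject K)
    (X : bimoduleObject M) : is_cochain_complex (hoch_complex X).
Proof.
have diffB k : zmod_morphism (@hoch_diff K M X k).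
  case: k => [[|n]|[|n]] f g; [exact: hoch_diffB0|exact: hoch_diffB_pos| |];
  by rewrite /= subr0.
split=> // -[[|n]|[|[|n]]] f //; [exact: hoch_diffK0|exact: hoch_diffK_pos|].
(* Degree -1 asks for d^0 0 = 0, which is additivity at 0 - 0. *)
by have := diffB 0 0 0; rewrite !subrr.
Qed.

Lemma alternating_diff_hoch (K : abMonoidalCategory) (M : monoidObject K)
    (X : bimoduleObject M) k f :
  @alternating_diff (hoch_cosimplicial X) k f = @hoch_diff K M X k f.
Proof.
case: k f => [[|n]|[|n]] f //=.
rewrite big_ord_recl big_ord_recr /= expr0 mulr1z addrA; congr (_ + _ + _).
  apply: eq_bigr => -[[|j] h] _ //=; congr (_ *~ _).
  (* An inner index passes the bound test of [hoch_coface]; the two proofs of the bound agree. *)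
  case: {-}_ / idP => [h'|//]; by rewrite (bool_irrelevance h' h).
congr (_ *~ _).
(* The last index n+2 fails the test, which selects the right action. *)
case: {-}_ / idP => [h'|//]; by have := h'; rewrite ltnn.
Qed.

Theorem theorem3p8 (K : abMonoidalCategory) (M : monoidObject K)
    (X : bimoduleObject M) :
  is_cochain_complex (alternating_complex (hoch_cosimplicial X)) /\
  alternating_complex (hoch_cosimplicial X) = hoch_complex X.
Proof.
have -> : alternating_complex (hoch_cosimplicial X) = hoch_complex X.
  (* Both complexes have convertible objects, so only the differentials are compared, with no
     transport. *)
  congr (CochainSeq _); apply: functional_extensionality_dep => k.
  by apply/funext => f; exact: alternating_diff_hoch.
by split; first exact: hoch_complexP.
Qed.
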